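(* Let $A$ be a commutative group, $L$ a loop with the right inverse property with identity $\epsilon$, and let $\Sigma=\{(\xi,\epsilon):\xi\in L\}\cup\{(\epsilon,\xi):\xi\in L\}\cup\{(\xi^{-1},\xi):\xi\in L\}\subset L\times L$. Consider the following conditions on maps $P,Q:L\times L\to\mathrm{Aut}(A)$: (i) On $\Sigma$: $P(\xi,\epsilon)=\mathrm{Id}$ and $Q(\epsilon,\xi)=\mathrm{Id}$ for all $\xi\in L$; the values $Q(\xi,\epsilon)$, $\xi\neq\epsilon$, are arbitrary; $P(\xi^{-1},\xi)=P(\epsilon,\xi^{-1})^{-1}=p(\xi)$ and $Q(\xi^{-1},\xi)=q(\xi)$ for all $\xi\in L$, where $q:L\to\mathrm{Aut}(A)$ is an arbitrary map with $q(\epsilon)=\mathrm{Id}$ and $p:L\to\mathrm{Aut}(A)$ is a map with $p(\epsilon)=\mathrm{Id}$ satisfying $p(\xi^{-1})=q(\xi^{-1})p(\xi)^{-1}q(\xi)$ for all $\xi\in L$. (ii) For all $(\xi,\eta)\in(L\times L)\setminus\Sigma$: $$P(\xi\eta,\eta^{-1})=P(\xi,\eta)^{-1},\qquad Q(\xi\eta,\eta^{-1})=P(\xi,\eta)^{-1}Q(\xi,\eta)\,P(\eta,\eta^{-1})^{-1}Q(\eta,\eta^{-1}).$$ Every linear abelian extension $F(P,Q)$ of $A$ by $L$ determined by maps $P,Q$ satisfying (i) and (ii) has the right inverse property. Conversely, every linear abelian extension $F(P,Q)$ of $A$ by $L$ having the right inverse property fulfills (i) and (ii).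
   Context: A loop is a set with a binary multiplication having a two-sided identity element such that all left and right translations are bijections. A loop $L$ has the right inverse property if there is a bijection $\iota:L\to L$ with $yx\cdot\iota(x)=y$ for all $x,y\in L$; then left and right inverses of every $x$ coincide and $\iota(x)=x^{-1}$. Let $A=(A,+)$ be a commutative group and $L$ a loop with identity $\epsilon$. A loop cocycle is a pair $(P,Q)$ of maps $P,Q:L\times L\to\mathrm{Aut}(A)$ with $P(\alpha,\epsilon)=\mathrm{Id}=Q(\epsilon,\beta)$ for all $\alpha,\beta\in L$. The linear abelian extension $F(P,Q)$ of $A$ by $L$ determined by the cocycle $(P,Q)$ is the loop on $L\times A$ with multiplication $(\alpha,a)\cdot(\beta,b)=(\alpha\beta,\,P(\alpha,\beta)a+Q(\alpha,\beta)b)$ and identity $(\epsilon,0)$. *)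

(* Defs.v *)
From HB Require Import structures.
From mathcomp Require Import all_boot all_algebra.
From mathcomp Require Import boolp classical_sets.

Set Implicit Arguments.
Unset Strict Implicit.
Unset Printing Implicit Defensive.

Import GRing.Theory.

Local Open Scope ring_scope.
Local Open Scope group_scope.

(* `bijective` only asserts the existence of the inverse translations; divisions
   are not part of the data. *)
HB.mixin Record UMagma_isLoop L of UMagma L := {
  ltrans_bij : forall x : L, bijective (fun y : L => x * y);
  rtrans_bij : forall x : L, bijective (fun y : L => y * x)
}.

#[short(type="loopType")]
HB.structure Definition Loop := {L of UMagma_isLoop L & UMagma L}.

(* Such an iota is unique, since x * iota x = 1 and left translations are
   injective; it is the map written x |-> x^-1. *)
Definition right_inverse_map (L : loopType) (iota : L -> L) : Prop :=
  bijective iota /\ forall x y : L, (y * x) * iota x = y.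

Definition right_inverse_property (L : loopType) : Prop :=
  exists iota : L -> L, right_inverse_map iota.

(* The automorphism group of an abelian group, with composition as product.
   boolp supplies equality and choice on functions A -> A, so that equality of
   automorphisms is Leibniz equality. *)
Section Automorphisms.
Variable A : zmodType.

Record zmod_aut := ZmodAut {
  aut_fun :> A -> A;
  _ : `[< zmod_morphism aut_fun /\ bijective aut_fun >]
}.

HB.instance Definition _ := [isSub for aut_fun].
HB.instance Definition _ := [Choice of zmod_aut by <:].

Implicit Types f g : zmod_aut.

Lemma autP f g : f =1 g -> f = g.
Proof. by move=> fg; apply/val_inj/funext. Qed.

Fact aut_morphism f : zmod_morphism f.
Proof. by case: f => h /= /asboolP[]. Qed.

HB.instance Definition _ f := GRing.isZmodMorphism.Build A A f (@aut_morphism f).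

Lemma aut_bij f : bijective f.
Proof. by case: f => h /= /asboolP[]. Qed.

Fact aut_one_subproof : `[< zmod_morphism (@id A) /\ bijective (@id A) >].
Proof. by apply/asboolP; split=> //; exists id. Qed.

Definition aut_one := ZmodAut aut_one_subproof.

Fact aut_mul_subproof f g :
  `[< zmod_morphism (fun a => f (g a)) /\ bijective (fun a => f (g a)) >].
Proof.
apply/asboolP; split=> [a b|]; first by rewrite !raddfB.
exact: bij_comp (aut_bij f) (aut_bij g).
Qed.

Definition aut_mul f g := ZmodAut (aut_mul_subproof f g).

Fact aut_inv_ex f : exists h : A -> A, cancel f h /\ cancel h f.
Proof. by have [h fK hK] := aut_bij f; exists h. Qed.

Definition aut_inv_fun f : A -> A := projT1 (cid (aut_inv_ex f)).

Fact aut_funK f : cancel f (aut_inv_fun f).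
Proof. by rewrite /aut_inv_fun; case: cid => h []. Qed.

Fact aut_inv_funK f : cancel (aut_inv_fun f) f.
Proof. by rewrite /aut_inv_fun; case: cid => h []. Qed.

Fact aut_inv_subproof f :
  `[< zmod_morphism (aut_inv_fun f) /\ bijective (aut_inv_fun f) >].
Proof.
apply/asboolP; split; last by exists f; [exact: aut_inv_funK | exact: aut_funK].
by move=> a b; apply: (can_inj (aut_funK f)); rewrite aut_morphism !aut_inv_funK.
Qed.

Definition aut_inv f := ZmodAut (aut_inv_subproof f).

Fact aut_mulA : associative aut_mul.
Proof. by move=> f g h; exact: autP. Qed.
Fact aut_mul1 : left_id aut_one aut_mul. Proof. by move=> f; exact: autP. Qed.
Fact aut_1mul : right_id aut_one aut_mul. Proof. by move=> f; exact: autP. Qed.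
Fact aut_mulV : left_inverse aut_one aut_inv aut_mul.
Proof. by move=> f; apply: autP => a; apply: aut_funK. Qed.
Fact aut_Vmul : right_inverse aut_one aut_inv aut_mul.
Proof. by move=> f; apply: autP => a; apply: aut_inv_funK. Qed.

HB.instance Definition _ :=
  isGroup.Build zmod_aut aut_mulA aut_mul1 aut_1mul aut_mulV aut_Vmul.

Lemma aut1E (a : A) : (1 : zmod_aut) a = a. Proof. by []. Qed.
Lemma autME f g (a : A) : (f * g) a = f (g a). Proof. by []. Qed.
Lemma autVK f : cancel f (f^-1). Proof. exact: aut_funK. Qed.
Lemma autKV f : cancel (f^-1) f. Proof. exact: aut_inv_funK. Qed.

End Automorphisms.

Notation "''Aut' A" := (zmod_aut A) (at level 8, A at level 2).

Section LinearExtension.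
Variables (A : zmodType) (L : loopType).

Definition loop_cocycle (P Q : L -> L -> 'Aut A) : Prop :=
  (forall alpha : L, P alpha 1 = 1) /\ (forall beta : L, Q 1 beta = 1).

(* The carrier of the extension F(P, Q): the cocycle (P, Q) only selects the loop
   structure put on L * A below. *)
Definition linear_extension (P Q : L -> L -> 'Aut A) (c : loop_cocycle P Q)
  : Type := (L * A)%type.

Variables (P Q : L -> L -> 'Aut A) (c : loop_cocycle P Q).
Local Notation F := (linear_extension c).

HB.instance Definition _ := Choice.copy F (L * A)%type.

Definition linext_mul (x y : F) : F :=
  (x.1 * y.1, (P x.1 y.1 x.2 + Q x.1 y.1 y.2)%R).

Definition linext_one : F := (1, 0%R).

HB.instance Definition _ := hasMul.Build F linext_mul.

Fact linext_mul1x : left_id linext_one linext_mul.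
Proof.
by case=> b v; rewrite /linext_mul /= mul1g (proj2 c) raddf0 add0r aut1E.
Qed.

Fact linext_mulx1 : right_id linext_one linext_mul.
Proof.
by case=> b v; rewrite /linext_mul /= mulg1 (proj1 c) raddf0 addr0 aut1E.
Qed.

HB.instance Definition _ := Magma_isUMagma.Build F linext_mul1x linext_mulx1.

Lemma linext_mulE (x y : F) :
  x * y = ((x.1 * y.1, (P x.1 y.1 x.2 + Q x.1 y.1 y.2)%R) : F).
Proof. by []. Qed.

Fact linext_ltrans_bij (x : F) : bijective (fun y : F => x * y).
Proof.
case: x => a u; have [g aK gK] := ltrans_bij a.
exists (fun z : F => (g z.1, (Q a (g z.1))^-1 (z.2 - P a (g z.1) u)%R) : F).
  by case=> b v; rewrite linext_mulE /= aK addrAC subrr add0r aut_funK.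
by case=> b v; rewrite linext_mulE /= aut_inv_funK gK addrC subrK.
Qed.

Fact linext_rtrans_bij (x : F) : bijective (fun y : F => y * x).
Proof.
case: x => a u; have [g aK gK] := rtrans_bij a.
exists (fun z : F => (g z.1, (P (g z.1) a)^-1 (z.2 - Q (g z.1) a u)%R) : F).
  by case=> b v; rewrite linext_mulE /= aK addrK aut_funK.
by case=> b v; rewrite linext_mulE /= aut_inv_funK gK subrK.
Qed.

HB.instance Definition _ :=
  UMagma_isLoop.Build F linext_ltrans_bij linext_rtrans_bij.

End LinearExtension.

Section Conditions.
Variables (A : zmodType) (L : loopType) (iota : L -> L).
Variables (P Q : L -> L -> 'Aut A).

Local Open Scope classical_set_scope.

(* iota is meant to be the right inverse map of L. *)
Definition Sigma : set (L * L) :=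
  range (fun xi => (xi, 1)) `|` range (fun xi => (1, xi))
    `|` range (fun xi => (iota xi, xi)).

(* The values Q xi 1 for xi <> 1, and the map q away from 1, are unconstrained. *)
Definition cond_on_Sigma : Prop :=
  (forall xi : L, P xi 1 = 1 /\ Q 1 xi = 1) /\
  exists p q : L -> 'Aut A,
    [/\ q 1 = 1,
        p 1 = 1,
        forall xi : L, p (iota xi) = q (iota xi) * (p xi)^-1 * q xi
      & forall xi : L,
          [/\ P (iota xi) xi = (P 1 (iota xi))^-1,
              (P 1 (iota xi))^-1 = p xi
            & Q (iota xi) xi = q xi]].

Definition cond_off_Sigma : Prop :=
  forall xi eta : L, ~ Sigma (xi, eta) ->
    P (xi * eta) (iota eta) = (P xi eta)^-1 /\
    Q (xi * eta) (iota eta) =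
      (P xi eta)^-1 * Q xi eta * (P eta (iota eta))^-1 * Q eta (iota eta).

End Conditions.

(* Main.v *)
Require Import Defs.
From mathcomp Require Import all_boot all_algebra.
From mathcomp Require Import boolp.

(** Write x' for [iota x]. In any loop the identity (y x) x' = y forces
    x x' = 1 and x'' = x. An inverse of (eta, b) in the extension must therefore
    have first component eta', and the identity for
    ((xi, a) (eta, b)) (eta', b') = (xi, a) reads, on second components,
      P (xi eta) eta' (P xi eta a + Q xi eta b) + Q (xi eta) eta' b' = a.
    Taking b = 0 makes P (xi eta) eta' the inverse of P xi eta. Taking a = 0 and
    xi = 1 determines b' from b, and since b' may not depend on xi, what is left
    is the formula for Q (xi eta) eta'. So the extension has the right inverse
    property exactly when the two equations of [cond_off_Sigma] hold at every
    pair (xi, eta): this is [linext_ripP].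

    It remains to see what these equations say on Sigma. At (xi, 1) they are
    trivial; at (1, eta) they reduce to P eta eta' = (P 1 eta)^-1; at (eta', eta)
    they become P 1 eta' = (P eta' eta)^-1, the same requirement as at
    (1, eta'), together with
      1 = (P eta' eta)^-1 (Q eta' eta) (P eta eta')^-1 (Q eta eta'),
    which is the relation between p and q. This is [cond_SigmaP]. *)

Import GRing.Theory.

Local Open Scope ring_scope.
Local Open Scope group_scope.

Section AutomorphismTheory.
Variables (A : zmodType) (f : 'Aut A).

(* Stated on the coercion [aut_fun] rather than on the additive morphism that
   packs it, so that they chain with [autVK] and [autKV]. *)
Lemma aut0 : f 0%R = 0%R. Proof. exact: raddf0. Qed.
Lemma autN a : f (- a)%R = (- f a)%R. Proof. exact: raddfN. Qed.
Lemma autD a b : f (a + b)%R = (f a + f b)%R. Proof. exact: raddfD. Qed.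

End AutomorphismTheory.

Section RightInverses.
Variables (L : loopType) (i : L -> L).

Lemma loop_mulgI (x : L) : injective (fun y : L => x * y).
Proof. exact: bij_inj (ltrans_bij x). Qed.

Hypothesis iP : forall x y : L, (y * x) * i x = y.

Lemma rip_mulgV (x : L) : x * i x = 1.
Proof. by have := iP x 1; rewrite mul1g. Qed.

Lemma rip_inv1 : i 1 = 1.
Proof. by rewrite -[LHS]mul1g rip_mulgV. Qed.

(** Since (x x') x'' = x and x x' = 1. This makes right inverses two-sided and
    the inverse map bijective. *)
Lemma rip_invK : involutive i.
Proof. by move=> x; have := iP (i x) x; rewrite rip_mulgV mul1g. Qed.

Lemma rip_mulVg (x : L) : i x * x = 1.
Proof. by have := rip_mulgV (i x); rewrite rip_invK. Qed.

Lemma rip_of_identity : right_inverse_property L.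
Proof. by exists i; split; [exact: inv_bij rip_invK | exact: iP]. Qed.

End RightInverses.

Section Cocycle.
Variables (A : zmodType) (L : loopType) (iota : L -> L).
Hypothesis iotaP : forall x y : L, (y * x) * iota x = y.
Variables P Q : L -> L -> 'Aut A.

Definition rip_equations (xi eta : L) : Prop :=
  P (xi * eta) (iota eta) = (P xi eta)^-1 /\
  Q (xi * eta) (iota eta) =
    (P xi eta)^-1 * Q xi eta * (P eta (iota eta))^-1 * Q eta (iota eta).

Section Extension.
Variable c : loop_cocycle P Q.

(** The second component solves P eta eta' b + Q eta eta' b' = 0, the equation
    that makes the product of (eta, b) with its inverse equal to (1, 0). *)
Definition linext_inv (x : linear_extension c) : linear_extension c :=
  (iota x.1,
   (- (Q x.1 (iota x.1))^-1%g (P x.1 (iota x.1) x.2))%R).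

Lemma linext_invP (i : linear_extension c -> linear_extension c)
    (x : linear_extension c) :
  x * i x = 1 -> i x = linext_inv x.
Proof.
move=> xV; apply: (@loop_mulgI _ x); rewrite /= xV linext_mulE /=.
by rewrite rip_mulgV // autN autKV subrr.
Qed.

Lemma rip_equations_linext :
  (forall xi eta, rip_equations xi eta) -> right_inverse_property (linear_extension c).
Proof.
move=> PQ; apply: (@rip_of_identity _ linext_inv) => -[eta b] [xi a].
rewrite !linext_mulE /= iotaP; case: (PQ xi eta) => -> ->.
by rewrite autD autVK autN !autME autKV autVK addrK.
Qed.

(** The identity at b = 0 gives the equation for P, and at a = 0 the one for Q,
    once the inverse is known to be [linext_inv]. *)
Lemma linext_rip_equations :
  right_inverse_property (linear_extension c) -> forall xi eta, rip_equations xi eta.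
Proof.
case=> i [_ iF] xi eta.
have E a b : (P (xi * eta)%g (iota eta) (P xi eta a + Q xi eta b)
    - Q (xi * eta)%g (iota eta)
        ((Q eta (iota eta))^-1%g (P eta (iota eta) b)))%R = a.
  have /(congr1 snd) := iF ((eta, b) : linear_extension c) (xi, a).
  by rewrite (linext_invP _ _ (rip_mulgV _ _ iF _)) !linext_mulE /= autN.
have EP : P (xi * eta) (iota eta) = (P xi eta)^-1.
  apply: (mulIg (P xi eta)); rewrite mulVg; apply: autP => a.
  by have := E a 0%R; rewrite !aut0 subr0 addr0.
split=> //; apply: autP => d.
(* This b is chosen so that the inverse of (eta, b) is (eta', - d). *)
have := E 0%R ((P eta (iota eta))^-1 (Q eta (iota eta) d)).
by rewrite aut0 add0r autKV autVK EP => /eqP; rewrite subr_eq0 => /eqP <-.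
Qed.

Lemma linext_ripP :
  right_inverse_property (linear_extension c) <->
  forall xi eta, rip_equations xi eta.
Proof. by split; [exact: linext_rip_equations | exact: rip_equations_linext]. Qed.

End Extension.

Lemma cond_Sigma_rip_equations :
  cond_on_Sigma iota P Q -> cond_off_Sigma iota P Q ->
  forall xi eta, rip_equations xi eta.
Proof.
move=> [PQ1 [p [q [_ _ pq PQV]]]] offS xi eta.
have P1V x : P x (iota x) = (P 1 x)^-1.
  by have [] := PQV (iota x); rewrite !(rip_invK _ _ iotaP).
have [] := pselect (Sigma iota (xi, eta)); last exact: offS.
case=> [[[x _ [<- <-]]|[x _ [<- <-]]]|[x _ [<- <-]]]; rewrite /rip_equations.
- rewrite (rip_inv1 _ _ iotaP) mulg1 (proj1 (PQ1 x)) (proj1 (PQ1 1)).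
  by rewrite (proj2 (PQ1 1)) invg1 mul1g !mulg1.
- by rewrite mul1g P1V (proj2 (PQ1 x)) invgK mulg1 mulVg mul1g.
- have [Px px Qx] := PQV x; have [PVx pVx QVx] := PQV (iota x).
  rewrite (rip_invK _ _ iotaP) in PVx pVx QVx.
  rewrite (rip_mulVg _ _ iotaP) (proj2 (PQ1 _)) Px invgK QVx Qx; split=> //.
  rewrite PVx pVx pq -px !invgM !invgK !mulgA.
  by rewrite mulgK mulgV mul1g mulVg.
Qed.

Lemma rip_equations_cond_Sigma :
  loop_cocycle P Q -> (forall xi eta, rip_equations xi eta) ->
  cond_on_Sigma iota P Q /\ cond_off_Sigma iota P Q.
Proof.
move=> [P1 Q1] PQ; split; last by move=> xi eta _; exact: PQ.
have iV := rip_invK _ _ iotaP; have i1 := rip_inv1 _ _ iotaP.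
split=> //; exists (fun x => P (iota x) x), (fun x => Q (iota x) x).
split=> [||x|x]; rewrite ?i1 //.
- have [_] := PQ (iota x) x; rewrite (rip_mulVg _ _ iotaP) Q1 iV => E.
  set u := P (iota x) x in E *; set v := Q (iota x) x in E *.
  set r := P x _ in E *; set s := Q x _ in E *.
  (* 1 = u^-1 v r^-1 s is rotated cyclically into 1 = s u^-1 v r^-1. *)
  apply: (mulIg r^-1); rewrite mulgV; apply: (mulIg s).
  by rewrite mul1g -!mulgA [u^-1 * _]mulgA [_ * (_ * s)]mulgA -E mulg1.
- have [E _] := PQ (iota x) x; rewrite (rip_mulVg _ _ iotaP) in E.
  by rewrite E invgK.
Qed.

Lemma cond_SigmaP :
  loop_cocycle P Q ->
  cond_on_Sigma iota P Q /\ cond_off_Sigma iota P Q <->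
  forall xi eta, rip_equations xi eta.
Proof.
move=> c; split=> [[onS offS]|]; first exact: cond_Sigma_rip_equations.
exact: rip_equations_cond_Sigma.
Qed.

End Cocycle.

Theorem corollary8 (A : zmodType) (L : loopType) (iota : L -> L)
    (L_rip : right_inverse_map iota) :
  (forall (P Q : L -> L -> 'Aut A) (c : loop_cocycle P Q),
      cond_on_Sigma iota P Q -> cond_off_Sigma iota P Q ->
      right_inverse_property (linear_extension c)) /\
  (forall (P Q : L -> L -> 'Aut A) (c : loop_cocycle P Q),
      right_inverse_property (linear_extension c) ->
      cond_on_Sigma iota P Q /\ cond_off_Sigma iota P Q).
Proof.
have [_ iotaP] := L_rip.
split=> P Q c; rewrite (linext_ripP _ _ _ iotaP).
  by move=> onS offS; apply/(cond_SigmaP _ _ _ iotaP _ _ c).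
by move=> PQ; apply/(cond_SigmaP _ _ _ iotaP _ _ c).
Qed.
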